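(* If $\mathfrak{c} = \mathfrak b^{+n}$ for some $n < \omega$ (where $\mathfrak c = 2^{\aleph_0}$), then $\mathfrak{d}^\mathfrak{c}_\mathfrak b = \mathfrak{d}(\leq^*_{\{\emptyset\}})$.
   Context: For $x,y\in\omega^\omega$, $x \leq^* y$ iff $x(k)\le y(k)$ for all but finitely many $k$; $\mathfrak b$ is the classical bounding number for $\le^*$. $\kappa^{+n}$ denotes the $n$-th successor cardinal of $\kappa$. For $f,g:\omega^\omega\to\omega^\omega$, $f \leq^*_{\{\emptyset\}} g$ iff $f(x)\le^* g(x)$ for every $x$; $\mathfrak d(\leq^*_{\{\emptyset\}})$ is the least size of a family $D$ of functions $\omega^\omega\to\omega^\omega$ such that every $f:\omega^\omega\to\omega^\omega$ has $g\in D$ with $f\le^*_{\{\emptyset\}} g$. For cardinals $\kappa\le\lambda$ and $f,g\in\kappa^\lambda$, $f\le^* g$ iff $|\{\alpha<\lambda : f(\alpha)>g(\alpha)\}|<\kappa$; $\mathfrak d^\lambda_\kappa$ is the least size of a $\le^*$-dominating subset of $\kappa^\lambda$. *)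

(* Defs.v *)
From mathcomp Require Import all_boot.
From mathcomp Require Import boolp contra wochoice classical_sets functions cardinality.

Set Implicit Arguments.
Unset Strict Implicit.
Unset Printing Implicit Defensive.

Local Open Scope classical_set_scope.
Local Open Scope card_scope.

Definition card_lt T U (A : set T) (B : set U) : bool :=
  (A #<= B) && ~~ (B #<= A).
Notation "A '#<' B" := (card_lt A B) (at level 79) : card_scope.

(* A cardinal is an initial ordinal, presented as a well-ordered type each    *)
(* proper initial segment of which is strictly smaller in cardinality.  Such  *)
(* a presentation is unique up to isomorphism only, so equality of cardinals  *)
(* [k] and [l] is [[set: k] #= [set: l]].  As [ole] is total, [~~ ole a b] says b < a. *)
Record cardinal := Cardinal {
  csort :> Type;
  ole : rel csort;
  ole_well_order : well_order ole;
  ole_initial : forall a, [set b | ~~ ole a b] #< [set: csort] }.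

Definition least_cardinal (P : cardinal -> Prop) (k : cardinal) : Prop :=
  P k /\ forall l : cardinal, P l -> [set: k] #<= [set: l].

Lemma cardinal0_well_order : well_order (fun _ _ : False => true).
Proof. by move=> A []. Qed.

Lemma cardinal0_initial (a : False) :
  [set b : False | ~~ (fun _ _ : False => true) a b] #< [set: False].
Proof. by case: a. Qed.

Definition cardinal0 : cardinal := Cardinal cardinal0_well_order cardinal0_initial.

(* The value [cardinal0] is only taken on the empty class ([min_cardP]); the  *)
(* classes used for b, c, successors and the dominating numbers are shown     *)
(* nonempty below.                                                            *)
Definition min_card (P : cardinal -> Prop) : cardinal :=
  if pselect (exists k, least_cardinal P k) is left h then projT1 (cid h)
  else cardinal0.

Definition card_of T (A : set T) : cardinal :=
  min_card (fun k => A #= [set: k]).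

Definition min_size T (F : set (set T)) : cardinal :=
  min_card (fun k => exists2 A, F A & A #= [set: k]).

Definition succ_card (k : cardinal) : cardinal :=
  min_card (fun l => [set: k] #< [set: l]).

Definition unbounded T (R : T -> T -> Prop) (B : set T) : Prop :=
  ~ exists g, forall f, B f -> R f g.

Definition dominating T (R : T -> T -> Prop) (D : set T) : Prop :=
  forall f, exists2 g, D g & R f g.

Definition bounding_number T (R : T -> T -> Prop) : cardinal :=
  min_size (unbounded R).

Definition dominating_number T (R : T -> T -> Prop) : cardinal :=
  min_size (dominating R).

Definition le_star (x y : nat -> nat) : Prop :=
  finite_set [set k | ~~ (x k <= y k)%N].

Definition le_star_empty (f g : (nat -> nat) -> (nat -> nat)) : Prop :=
  forall x, le_star (f x) (g x).

Definition le_star_card (l k : cardinal) (f g : l -> k) : Prop :=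
  [set a | ~~ ole (f a) (g a)] #< [set: k].

Definition frak_c : cardinal := card_of [set: nat -> bool].
Definition frak_b : cardinal := bounding_number le_star.
Definition frak_d_empty : cardinal := dominating_number le_star_empty.
Definition frak_d (l k : cardinal) : cardinal :=
  dominating_number (@le_star_card l k).

Lemma inj_card_leT T U (f : T -> U) : injective f -> [set: T] #<= [set: U].
Proof.
move=> finj; have [g] : $|{injfun [set: T] >-> [set: U]}|.
  by apply/injfunPex; exists f => // x y _ _ /finj.
exact: inj_card_le g.
Qed.

Lemma card_least (I : Type) (A : I -> Type) (i0 : I) :
  exists i, forall j, [set: A i] #<= [set: A j].
Proof.
pose P (S : set (forall i, A i)) :=
  forall s t, S s -> S t -> forall i, s i = t i -> s = t.
have [F FP Ftot|M [PM Mmax]] := @Zorn_bigcup _ P.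
  move=> s t [X FX Xs] [Y FY Yt] i st.
  have [XY|YX] := Ftot _ _ FX FY.
  - exact: FP FY _ _ (XY _ Xs) Yt i st.
  - exact: FP FX _ _ Xs (YX _ Yt) i st.
have [[i iP]|nsurj] :=
    pselect (exists i, forall x : A i, exists2 s, M s & s i = x).
  exists i => j.
  have [|h hP] := @boolp.choice _ _ (fun (x : A i) s => M s /\ s i = x).
    by move=> x; have [s] := iP x; exists s.
  apply: (@inj_card_leT _ _ (fun x => h x j)) => x y hxy.
  have [Mx hx] := hP x; have [My hy] := hP y.
  by rewrite -hx -hy (PM _ _ Mx My j hxy).
have ex i : exists x : A i, forall s, M s -> s i <> x.
  apply: contrapT => nx; apply: nsurj; exists i => x; apply: contrapT => nM.
  by apply: nx; exists x => s Ms sx; apply: nM; exists s.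
pose t i := projT1 (cid (ex i)).
have tP i s : M s -> s i <> t i by rewrite /t; case: (cid (ex i)) => x /=; exact.
exfalso; apply: (Mmax (M `|` [set t])).
  split; first by move=> s Ms; left.
  by move=> /(_ t (or_intror erefl)) /(tP i0); exact.
move=> s s' [Ms|->] [Ms'|->] i //; first exact: PM.
- by move/(tP _ _ Ms).
- by move/esym/(tP _ _ Ms').
Qed.

Lemma card_le_total T U (A : set T) (B : set U) : (A #<= B) || (B #<= A).
Proof.
have [b bP] := @card_least bool (fun b => if b then set_type A else set_type B) true.
rewrite -(card_le_eql (card_setT A)) -(card_le_eqr (card_setT B)).
rewrite -(card_le_eql (card_setT B)) -(card_le_eqr (card_setT A)).
by apply/orP; case: b bP => bP; [left; exact: (bP false)|right; exact: (bP true)].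
Qed.

Lemma least_cardinal_exists (P : cardinal -> Prop) :
  (exists k, P k) -> exists k, least_cardinal P k.
Proof.
move=> [k Pk].
pose Q (A : set k) := exists2 l, P l & A #= [set: l].
have Qk : Q setT by exists k => //; exact: card_eqxx.
have [[A [l Pl Al]] AP] :=
  @card_least {A | Q A} (fun A => set_type (sval A)) (exist _ setT Qk).
exists l; split=> // m Pm; rewrite -(card_le_eql Al) -(card_le_eql (card_setT A)).
have [km|mk] := orP (card_le_total [set: k] [set: m]).
  apply: card_le_trans km; rewrite -(card_le_eqr (card_setT [set: k])).
  exact: (AP (exist _ setT Qk)).
have [B Bm _] := card_subP _ _ mk.
have QB : Q B by exists m.
rewrite -(card_le_eqr Bm) -(card_le_eqr (card_setT B)).
exact: (AP (exist _ B QB)).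
Qed.

Lemma min_cardP (P : cardinal -> Prop) :
  (exists k, P k) -> least_cardinal P (min_card P).
Proof.
move=> /least_cardinal_exists h; rewrite /min_card.
by case: pselect => // h'; case: (cid h').
Qed.

Lemma ole_total (T : Type) (R : rel T) : well_order R -> total R.
Proof.
move=> Rwo x y.
have [|z [[]]] := Rwo (fun z => `[< z = x \/ z = y >]).
  by exists x; apply/asboolP; left.
move=> /asboolP[] -> /(_ _ _)h _; apply/orP; [left|right]; apply: h;
  by apply/asboolP; (left + right).
Qed.

Lemma ole_trans (T : Type) (R : rel T) : well_order R ->
  forall x y z, R x y -> R y z -> R x z.
Proof.
elim/Peq: T => T in R * => Rwo x y z.
have [|w [[]]] := Rwo (fun w => `[< [\/ w = x, w = y | w = z] >]).
  by exists x; apply/asboolP; constructor 1.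
move=> wP wmin wuniq Rxy Ryz.
have mx : R w x by apply: wmin; apply/asboolP; constructor 1.
have my : R w y by apply: wmin; apply/asboolP; constructor 2.
have mz : R w z by apply: wmin; apply/asboolP; constructor 3.
have uniq2 a b : R a b -> R b a -> a = b.
  move=> Rab Rba.
  have wo : wo_chain R predT by exact: withinW.
  by apply: (wo_chain_antisymmetric wo); rewrite // Rab.
move/asboolP: wP => [] wE; subst w => //.
- by rewrite (uniq2 _ _ Rxy mx).
- by rewrite -(uniq2 _ _ Ryz my).
Qed.

Lemma well_order_exists (T : Type) : exists R : rel T, well_order R.
Proof. by elim/Peq: T => T; have [R] := well_ordering_principle T; exists R. Qed.

Lemma cardinal_exists T (A : set T) : exists k : cardinal, A #= [set: k].
Proof.
suff H (U : Type) : exists k : cardinal, [set: U] #= [set: k].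
  by have [k] := H (set_type A); rewrite (card_eql (card_setT A)); exists k.
have [R Rwo] := well_order_exists U.
have Rtr := ole_trans Rwo.
have [[a aP]|nex] := pselect (exists a, [set: U] #<= [set b | ~~ R a b]); last first.
  have init a : [set b | ~~ R a b] #< [set: U].
    by rewrite /card_lt card_leT; apply/negP => h; apply: nex; exists a.
  by exists (Cardinal Rwo init).
have [|m [[/asboolP mP mmin] _]] :=
    Rwo (fun a => `[< [set: U] #<= [set b | ~~ R a b] >]).
  by exists a; apply/asboolP.
pose S := {b | ~~ R m b}; pose RS : rel S := fun x y => R (sval x) (sval y).
have RSwo : well_order RS.
  move=> B [x Bx].
  have [|z [[/asboolP[y [By ym]] zmin] zu]] :=
      Rwo (fun b => `[< exists y : S, y \in B /\ sval y = b >]).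
    by exists (sval x); apply/asboolP; exists x.
  exists y; split.
    split=> // w Bw; rewrite /RS ym; apply: zmin.
    by apply/asboolP; exists w.
  move=> w [Bw wmin]; apply/val_inj; rewrite /= ym; apply: zu; split.
    by apply/asboolP; exists w.
  by move=> _ /asboolP[v [Bv <-]]; exact: wmin.
have US : [set: U] #= [set: S].
  apply: Cantor_Bernstein; last exact: (@inj_card_leT _ _ _ (@val_inj _ _ S)).
  apply: card_le_trans mP _.
  have -> : [set b | ~~ R m b] = sval @` [set: S].
    apply/seteqP; split=> [b mb|_ [x _ <-]]; last exact: (svalP x).
    by exists (exist _ b mb).
  exact: card_image_le.
have RSinit x : [set y | ~~ RS x y] #< [set: S].
  rewrite /card_lt card_leT; apply/negP => h.
  have := svalP x; rewrite (mmin (sval x)) //; apply/asboolP.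
  rewrite (card_le_eql US); apply: (card_le_trans h).
  rewrite -(card_le_eql (inj_card_eq (in2W (@val_inj _ _ S)))).
  by apply: subset_card_le => _ [y xy <-].
by exists (Cardinal RSwo RSinit).
Qed.

Lemma card_ofP T (A : set T) : A #= [set: card_of A].
Proof.
by have [|] := @min_cardP (fun k => A #= [set: k]); first exact: cardinal_exists.
Qed.

Lemma min_sizeP T (F : set (set T)) : F !=set0 ->
  (exists2 A, F A & A #= [set: min_size F]) /\
  (forall A, F A -> [set: min_size F] #<= A).
Proof.
move=> [A FA].
have [|Fm mP] := @min_cardP (fun k => exists2 A, F A & A #= [set: k]).
  by have [k Ak] := cardinal_exists A; exists k, A.
split=> // B FB; have [k Bk] := cardinal_exists B.
by rewrite (card_le_eqr Bk); apply: mP; exists B.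
Qed.

Lemma succ_cardP (k : cardinal) : [set: k] #< [set: succ_card k] /\
  (forall T (A : set T), [set: k] #< A -> [set: succ_card k] #<= A).
Proof.
have [|km mP] := @min_cardP (fun l => [set: k] #< [set: l]).
  have [l kl] := cardinal_exists [set: set k]; exists l => /=.
  rewrite /card_lt -(card_le_eqr kl) -(card_le_eql kl); apply/andP; split.
    apply: (@inj_card_leT _ _ set1) => x y /seteqP[/(_ x erefl) ->] //.
  apply/negP => /card_leP[f].
  pose g (X : set k) : k := sval (f (SigSub (mem_set (I : [set: set k] X)))).
  have ginj X Y : g X = g Y -> X = Y.
    move=> /val_inj/(inj _ _) h.
    by have /(congr1 sval) := h (mem_set I) (mem_set I).
  pose D := [set x : k | exists2 X, g X = x & ~ X x].
  have [DgD|nD] := pselect (D (g D)).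
    by have [X /ginj -> nDgD] := DgD; exact: nDgD.
  by apply: (nD); exists D.
split=> // T A kA; have [l Al] := cardinal_exists A.
rewrite (card_le_eqr Al); apply: mP => /=.
by move: kA; rewrite /card_lt (card_le_eqr Al) (card_le_eql Al).
Qed.

Lemma le_star_unbounded : unbounded le_star setT.
Proof.
move=> [g /(_ (fun k => (g k).+1) I)]; rewrite /le_star.
have -> : [set k | ~~ ((g k).+1 <= g k)%N] = setT.
  by apply/seteqP; split=> k //= _; rewrite ltnn.
exact: infinite_nat.
Qed.

Lemma le_star_empty_dominating : dominating le_star_empty setT.
Proof.
move=> f; exists f => // x; rewrite /le_star.
have -> : [set k | ~~ (f x k <= f x k)%N] = set0; last exact: finite_set0.
by apply/seteqP; split=> k //=; rewrite leqnn.
Qed.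

Lemma frak_b_inhabited : inhabited frak_b.
Proof.
have [[A uA Ab] _] := min_sizeP (ex_intro _ _ le_star_unbounded).
apply: contrapT => nb; apply: uA; exists (fun _ => 0).
suff -> : A = set0 by move=> f.
apply/eqP; rewrite -(@card_le0 _ nat) (card_le_eql Ab).
by rewrite (_ : setT = set0) ?card_ge0 //; apply/seteqP; split=> // x _; apply: nb.
Qed.

Lemma le_star_card_dominating (l k : cardinal) :
  inhabited k -> dominating (@le_star_card l k) setT.
Proof.
move=> [x] f; exists f => //; rewrite /le_star_card.
have -> : [set a | ~~ ole (f a) (f a)] = set0.
  apply/seteqP; split=> a //=.
  by have := ole_total (@ole_well_order k) (f a) (f a); rewrite orbb => ->.
rewrite /card_lt card_ge0 card_le0; apply/negP => /eqP k0.
by have : [set: k] x by []; rewrite k0.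
Qed.

(* Main.v *)
Require Import Defs.
From mathcomp Require Import all_boot.
From mathcomp Require Import boolp wochoice classical_sets functions cardinality.

Set Implicit Arguments.
Unset Strict Implicit.
Unset Printing Implicit Defensive.

Local Open Scope classical_set_scope.
Local Open Scope card_scope.

(** Write b and c for the two cardinals and [<=*] for eventual domination.

    d(c, b) is at most the dominating number of functionals: for an unbounded
    family [u] of size b and bounds [v x] of [{u a | a < x}], a functional
    dominating [v \o f] yields a function dominating [f : c -> b] everywhere.

    For the converse, sets of fewer than b reals are [<=*]-bounded, so it
    suffices to find d(c, b)-many slaloms, with values of size [< b], that
    localize all functions [c -> c].  For functions [c -> b] these are initial
    segments.  One climbs from [k] to its successor up to c = b^{+n}: a value
    [f a < k^+] is coded below every large [x < k^+] by an element of [k], and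
    the values caught for all large [x] number fewer than b, since b-many of
    them would, by regularity of [k^+], all be caught at a single [x]. *)

(** * Injections and the arithmetic of infinite cardinals *)

Lemma card_le_fun T U (A : set T) (B : set U) (f : T -> U) :
    (forall x, A x -> B (f x)) ->
    (forall x y, A x -> A y -> f x = f y -> x = y) -> A #<= B.
Proof.
move=> fAB finj; have [g] : $|{injfun A >-> B}|.
  by apply/injfunPex; exists f => // x y /set_mem Ax /set_mem Ay; exact: finj.
exact: inj_card_le g.
Qed.

Lemma card_le_exfun T U (A : set T) (B : set U) : inhabited U -> A #<= B ->
  exists2 f : T -> U, (forall x, A x -> B (f x)) &
    (forall x y, A x -> A y -> f x = f y -> x = y).
Proof.
elim/Ppointed: U => U in B *; first by move=> [/no].
move=> _ /pcard_leP/injfunPex[f fAB finj]; exists f => // x y Ax Ay.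
by apply: finj; exact/mem_set.
Qed.

Lemma exists_retract T U (x : T) : [set: T] #<= [set: U] ->
  exists (j : T -> U) (r : U -> T), cancel j r.
Proof.
move=> TU; have u : inhabited U.
  apply: contrapT => nU.
  have U0 : [set: U] = set0 by apply/seteqP; split=> // u _; apply: nU.
  by move: TU; rewrite U0 card_le0 => /eqP/seteqP[/(_ x I)].
have [j _ jinj] := card_le_exfun u TU.
have /boolp.choice[r rP] : forall y, exists z, (exists t, j t = y) -> j z = y.
  move=> y; have [[t <-]|nt] := pselect (exists t, j t = y); first by exists t.
  by exists x => /nt.
by exists j, r => t; apply: jinj => //; apply: rP; exists t.
Qed.

Lemma card_ltNge T U (A : set T) (B : set U) : (A #< B) = ~~ (B #<= A).
Proof.
rewrite /card_lt; have := card_le_total A B.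
by case: (A #<= B); case: (B #<= A).
Qed.

Lemma card_leX T1 T2 U1 U2 (A1 : set T1) (A2 : set T2) (B1 : set U1) (B2 : set U2) :
  A1 #<= B1 -> A2 #<= B2 -> A1 `*` A2 #<= B1 `*` B2.
Proof.
elim/Ppointed: U1 => U1 in B1 *.
  by rewrite !emptyE_subdef => ->; rewrite set0X.
elim/Ppointed: U2 => U2 in B2 *.
  by rewrite !emptyE_subdef => _ ->; rewrite setX0.
move=> /(card_le_exfun (inhabits point))[f fAB finj].
move=> /(card_le_exfun (inhabits point))[g gAB ginj].
apply: (@card_le_fun _ _ _ _ (fun x => (f x.1, g x.2))).
  by move=> x [/fAB ? /gAB].
move=> [x1 x2] [y1 y2] [/= Ax1 Ax2] [/= Ay1 Ay2] [fxy gxy].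
by rewrite (finj _ _ Ax1 Ay1 fxy) (ginj _ _ Ax2 Ay2 gxy).
Qed.

(** Two distinct points of [B] tag the pieces, which embeds the union in the square of [B]; a common
    point counts in [A1]. *)
Lemma card_leU_sq T U (A1 A2 : set T) (B : set U) :
    infinite_set B -> B `*` B #<= B -> A1 #<= B -> A2 #<= B -> A1 `|` A2 #<= B.
Proof.
move=> Binf BB A1B A2B.
have [a Ba] := infinite_setN0 Binf.
have [b [Bb ba]] : B `\ a !=set0.
  exact/infinite_setN0/(infinite_setD Binf)/finite_set1.
have [f fB finj] := card_le_exfun (inhabits a) A1B.
have [g gB ginj] := card_le_exfun (inhabits a) A2B.
apply: card_le_trans BB.
apply: (@card_le_fun _ _ _ _ (fun x => if x \in A1 then (a, f x) else (b, g x))).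
  move=> x [Ax|Ax]; first by rewrite (mem_set Ax); split=> //=; exact: fB.
  by case: ifPn => [/set_mem ?|_]; split=> //=; [exact: fB|exact: gB].
move=> x y Ax Ay.
case: ifPn => xA; case: ifPn => yA [].
- by apply: finj; exact: set_mem.
- by move=> /esym/ba.
- by move=> /ba.
have [/mem_set|Ax2] := Ax; first by rewrite (negbTE xA).
have [/mem_set|Ay2] := Ay; first by rewrite (negbTE yA).
exact: ginj.
Qed.

(* A maximal partial pairing [X * X -> X] exists by Zorn; if [~` X] contained a
   copy [Y] of [X], the pairing of [Y] would extend it to [X `|` Y]. *)
Lemma card_leXX T : infinite_set [set: T] -> [set: T * T] #<= [set: T].
Proof.
elim/Ppointed: T => T Tinf.
  by exfalso; apply: Tinf; rewrite empty_eq0; exact: finite_set0.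
pose fld (G : set (T * T * T)) x := exists y z, G (x, y, z).
pose P (G : set (T * T * T)) :=
  [/\ forall p z z', G (p, z) -> G (p, z') -> z = z',
      forall p p' z, G (p, z) -> G (p', z) -> p = p',
      forall x y z, G (x, y, z) -> fld G y /\ fld G z &
      forall x y, fld G x -> fld G y -> exists z, G (x, y, z)].
have fldS G H : G `<=` H -> fld G `<=` fld H.
  by move=> GH x [y [z /GH]]; exists y, z.
have [F FP Ftot|M [[Mfun Minj Mcl Mtot] Mmax]] := @Zorn_bigcup _ P.
  have F2 a b : (\bigcup_(X in F) X) a -> (\bigcup_(X in F) X) b ->
      exists2 X, F X & X a /\ X b.
    move=> [X FX Xa] [Y FY Yb]; have [XY|YX] := Ftot _ _ FX FY.
      by exists Y => //; split=> //; exact: XY.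
    by exists X => //; split=> //; exact: YX.
  split.
  - move=> p z z' Gz Gz'; have [X /FP[Xfun _ _ _] [Xz Xz']] := F2 _ _ Gz Gz'.
    exact: Xfun Xz Xz'.
  - move=> p p' z Gp Gp'; have [X /FP[_ Xinj _ _] [Xp Xp']] := F2 _ _ Gp Gp'.
    exact: Xinj Xp Xp'.
  - move=> x y z [X FX Xt]; have [_ _ + _] := FP _ FX => /(_ _ _ _ Xt)[Xy Xz].
    by split; [apply: fldS Xy|apply: fldS Xz] => t Xt'; exists X.
  - move=> x y [x' [x'' Gx]] [y' [y'' Gy]].
    have [X FX [Xx Xy]] := F2 _ _ Gx Gy; have [_ _ _ Xtot] := FP _ FX.
    have [||z Xz] := Xtot x y; first by exists x', x''.
      by exists y', y''.
    by exists z, X.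
set X := fld M in Mcl Mtot.
have XX : X `*` X #<= X.
  have [|p pP] := @boolp.choice _ _ (fun q z => X q.1 -> X q.2 -> M (q, z)).
    move=> [x y] /=; have [[Xx Xy]|nX] := pselect (X x /\ X y).
      by have [z] := Mtot _ _ Xx Xy; exists z.
    by exists point => Xx Xy; case: nX.
  apply: (@card_le_fun _ _ _ _ p).
    by move=> [x y] [/= Xx Xy]; have /Mcl[] := pP (x, y) Xx Xy.
  move=> q q' [Xq1 Xq2] [Xq'1 Xq'2] pq; apply: Minj (pP q Xq1 Xq2) _.
  by rewrite pq; exact: pP.
have ext (Y : set T) : infinite_set Y -> Y `<=` ~` X -> Y `*` Y #<= Y ->
    X #<= Y -> False.
  move=> Yinf YX YY XY.
  have [y0 Yy0] := infinite_setN0 Yinf.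
  have [p pY pinj] := card_le_exfun (inhabits y0) YY.
  have [j jY jinj] := card_le_exfun (inhabits y0)
    (card_leU_sq Yinf YY XY (card_lexx Y)).
  (* [N] pairs the couples not both in [X]: [j] moves the coordinates into [Y], where [p] codes
     them. The codes lie outside [X], so none is a value of [M]. *)
  pose N := [set t : T * T * T | [/\ (X `|` Y) t.1.1, (X `|` Y) t.1.2,
    ~ (X t.1.1 /\ X t.1.2) & t.2 = p (j t.1.1, j t.1.2)]].
  have MX x y z : M (x, y, z) -> [/\ X x, X y & X z].
    by move=> /[dup] Mt /Mcl[Xy Xz]; split=> //; exists y, z.
  have NY x y z : N (x, y, z) -> Y z.
    by move=> [/= Ux Uy _ ->]; apply: pY; split; exact: jY.
  have UN x y : (X `|` Y) x -> (X `|` Y) y -> exists z, (M `|` N) (x, y, z).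
    move=> Ux Uy; have [[Xx Xy]|nXX] := pselect (X x /\ X y).
      by have [z Mz] := Mtot _ _ Xx Xy; exists z; left.
    by exists (p (j x, j y)); right.
  have fldMN : fld (M `|` N) = X `|` Y.
    apply/seteqP; split=> [x [y [z [Mt|[]//]]]|x Ux].
      by left; exists y, z.
    by have [z ?] := UN x x Ux Ux; exists x, z.
  apply: (Mmax (M `|` N)).
    split; first by move=> t Mt; left.
    (* The extension is proper: [M] pairs nothing with [y0], which lies outside [X]. *)
    have [z MNz] := UN y0 y0 (or_intror Yy0) (or_intror Yy0).
    by move=> /(_ _ MNz)/MX[/YX].
  split.
  - move=> [x y] z z' [Mz|Nz] [Mz'|Nz'].
    + exact: Mfun Mz Mz'.
    + by have [Xx Xy _] := MX _ _ _ Mz; case: Nz' => _ _ [].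
    + by have [Xx Xy _] := MX _ _ _ Mz'; case: Nz => _ _ [].
    + by case: Nz => _ _ _ /= ->; case: Nz' => _ _ _ /= ->.
  - move=> [x y] [x' y'] z [Mz|Nz] [Mz'|Nz'].
    + exact: Minj Mz Mz'.
    + by have [_ _ Xz] := MX _ _ _ Mz; have /YX := NY _ _ _ Nz'.
    + by have [_ _ Xz] := MX _ _ _ Mz'; have /YX := NY _ _ _ Nz.
    + case: Nz => /= Ux Uy _ zE; case: Nz' => /= Ux' Uy' _.
      rewrite zE => pE.
      have [] : (j x, j y) = (j x', j y').
        by apply: pinj pE; split=> /=; exact: jY.
      by move=> /(jinj _ _ Ux Ux') -> /(jinj _ _ Uy Uy') ->.
  - rewrite fldMN => x y z [/MX[_ Xy Xz]|Nt]; first by split; left.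
    by case: (Nt) => _ Uy _ _; split=> //; right; exact: NY Nt.
  - by rewrite fldMN; exact: UN.
have [Xfin|Xinf] := pselect (finite_set X).
  have /infiniteP natX : infinite_set (~` X).
    by rewrite -setTD; exact: infinite_setD.
  have [Y Ynat YX] := card_subP _ _ natX.
  exfalso; apply: (ext Y) => //.
  - by apply/infiniteP; rewrite (card_le_eqr Ynat).
  - rewrite (card_le_eqr Ynat).
    apply: (@card_le_trans _ _ _ ([set: nat] `*` [set: nat])).
      by apply: card_leX; rewrite (card_le_eql Ynat).
    by rewrite setXTT (card_le_eql card_nat2).
  - by rewrite (card_le_eqr Ynat); exact: finite_set_countable.
have [XC|CX] := orP (card_le_total X (~` X)).
  have [Y YeqX YX] := card_subP _ _ XC.
  exfalso; apply: (ext Y) => //.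
  - by apply/infiniteP; rewrite (card_le_eqr YeqX); exact/infiniteP.
  - rewrite (card_le_eqr YeqX); apply: card_le_trans XX.
    by apply: card_leX; rewrite (card_le_eql YeqX).
  - by rewrite (card_le_eqr YeqX).
have TX : [set: T] #<= X.
  by rewrite -(setUv X); exact: card_leU_sq.
rewrite -setXTT; apply: card_le_trans (card_leX TX TX) _.
exact: card_le_trans XX (card_leT X).
Qed.

Lemma infinite_card_le T U (A : set T) (B : set U) :
  A #<= B -> infinite_set A -> infinite_set B.
Proof. by move=> AB Ainf /(card_le_finite AB). Qed.

Lemma card_leXT T U V : infinite_set [set: V] ->
  [set: T] #<= [set: V] -> [set: U] #<= [set: V] -> [set: T * U] #<= [set: V].
Proof.
move=> Vinf TV UV; apply: card_le_trans (card_leXX Vinf).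
by rewrite -!setXTT; exact: card_leX.
Qed.

Lemma card_leU_infinite T U (A1 A2 : set T) (B : set U) :
  infinite_set B -> A1 #<= B -> A2 #<= B -> A1 `|` A2 #<= B.
Proof.
move=> Binf; apply: card_leU_sq => //.
have eqB := card_setT B.
have : [set: B * B] #<= [set: B].
  apply: card_leXX; apply: infinite_card_le Binf.
  by rewrite (card_le_eqr eqB).
rewrite -setXTT (card_le_eqr eqB); apply: card_le_trans.
by apply: card_leX; rewrite (card_le_eqr eqB).
Qed.

(** * Initial segments and regularity of successor cardinals *)

Lemma well_order_anti T (R : rel T) : well_order R ->
  forall x y, R x y -> R y x -> x = y.
Proof.
elim/Peq: T => T in R * => Rwo x y Rxy Ryx.
have wo : wo_chain R predT by exact: withinW.
by apply: (wo_chain_antisymmetric wo); rewrite // Rxy.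
Qed.

(** The endpoint adds nothing to the cardinality of an infinite open segment, and a finite one stays
    finite. *)
Lemma closed_segment_lt (k : cardinal) (m : k) :
  infinite_set [set: k] -> [set x | ole x m] #< [set: k].
Proof.
move=> kinf.
have sub : [set x : k | ole x m] `<=` [set x | ~~ ole m x] `|` [set m].
  move=> x /= xm; have [mx|] := boolP (ole m x); last by left.
  by right; exact: (well_order_anti (@ole_well_order k)).
rewrite card_ltNge; apply/negP => kle.
have {kle sub}kle := card_le_trans kle (subset_card_le sub).
have [segfin|seginf] := pselect (finite_set [set x : k | ~~ ole m x]).
  by apply: (infinite_card_le kle kinf); rewrite finite_setU; split.
have := ole_initial m; rewrite card_ltNge => /negP; apply.
apply: card_le_trans kle _; apply: card_leU_infinite => //.
apply: card_le_trans ((infiniteP _).1 seginf).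
by apply: finite_set_countable.
Qed.

Lemma ole_unbounded (k : cardinal) (m : k) :
  infinite_set [set: k] -> exists x, ~~ ole x m.
Proof.
move=> kinf; apply: contrapT => nx.
have := closed_segment_lt m kinf; rewrite card_ltNge => /negP; apply.
apply: subset_card_le => x _ /=; apply: contrapT => /negP xm.
by apply: nx; exists x.
Qed.

Lemma card_le_succ (k : cardinal) : [set: k] #<= [set: succ_card k].
Proof. by have [/andP[]] := succ_cardP k. Qed.

Lemma card_le_iter_succ n (k : cardinal) : [set: k] #<= [set: iter n succ_card k].
Proof.
by elim: n => //= n /card_le_trans; apply; exact: card_le_succ.
Qed.

(** Closed segments of the successor are smaller than it, hence embed in [k] by its minimality. *)
Lemma succ_card_code (k : cardinal) : infinite_set [set: k] ->
  exists e : succ_card k -> succ_card k -> k,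
  forall b x y, ole x b -> ole y b -> e b x = e b y -> x = y.
Proof.
move=> kinf; have [p _] := infinite_setN0 kinf.
have sinf := infinite_card_le (card_le_succ k) kinf.
suff /boolp.choice[e eP] : forall b, exists f : succ_card k -> k,
    forall x y, ole x b -> ole y b -> f x = f y -> x = y by exists e.
move=> b; have : [set x | ole x b] #<= [set: k].
  apply: contrapT => /negP; rewrite -card_ltNge => kb.
  have := closed_segment_lt b sinf; rewrite card_ltNge => /negP; apply.
  exact: (succ_cardP k).2.
by move=> /(card_le_exfun (inhabits p))[f _ finj]; exists f.
Qed.

(** If [c] were unbounded, each [b] would lie below some [c t]; this [t] and the code of [b] below
    [c t] determine [b], so the successor would embed in [T * k]. *)
Lemma succ_card_regular (k : cardinal) T (c : T -> succ_card k) :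
    infinite_set [set: k] -> [set: T] #<= [set: k] ->
  exists b, forall t, ole (c t) b.
Proof.
move=> kinf Tk; apply: contrapT => cunb.
have [e einj] := succ_card_code kinf.
have /boolp.choice[h hP] : forall b, exists t, ole b (c t).
  move=> b; apply: contrapT => nb; apply: cunb; exists b => t.
  have := ole_total (@ole_well_order (succ_card k)) (c t) b.
  by case/orP => // bt; case: nb; exists t.
have [] := succ_cardP k; rewrite card_ltNge => /negP + _; apply.
apply: card_le_trans (card_leXT kinf Tk (card_lexx _)).
apply: (@inj_card_leT _ _ (fun b => (h b, e (c (h b)) b))) => x y [hxy].
by rewrite -hxy; apply: einj => //; rewrite hxy.
Qed.

(** * Slaloms: transfer and passage to successors *)

(** Functions are localized at every argument. Arbitrary types, not only cardinals, are allowed for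
    [I], [L] and [V], so that products can serve as [I] or [L], and the reals as [L] and [V]. *)
Definition slalom_cover (K : cardinal) (I L V : Type) :=
  exists2 S : I -> L -> set V, (forall i a, S i a #< [set: K]) &
    forall f : L -> V, exists i, forall a, S i a (f a).

Section SlalomCover.
Variable K : cardinal.

Lemma slalom_cover_index (I J L V : Type) (i : I) : [set: I] #<= [set: J] ->
  slalom_cover K I L V -> slalom_cover K J L V.
Proof.
move=> /(exists_retract i)[j [r rK]] [S Slt Scov].
exists (fun i => S (r i)) => // f; have [t tP] := Scov f.
by exists (j t) => a; rewrite rK.
Qed.

Lemma slalom_cover_dom (I L L' V : Type) (a : L') : [set: L'] #<= [set: L] ->
  slalom_cover K I L V -> slalom_cover K I L' V.
Proof.
move=> /(exists_retract a)[j [r rK]] [S Slt Scov].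
exists (fun i x => S i (j x)) => // f; have [i iP] := Scov (f \o r).
by exists i => x; have := iP (j x); rewrite /= rK.
Qed.

Lemma slalom_cover_codom (I L V V' : Type) (v : V) : [set: V'] #<= [set: V] ->
  slalom_cover K I L V -> slalom_cover K I L V'.
Proof.
move=> /(card_le_exfun (inhabits v))[j _ jinj] [S Slt Scov].
exists (fun i x => j @^-1` S i x) => [i x|f].
  have := Slt i x; rewrite !card_ltNge; apply: contra => h.
  apply: card_le_trans h _; apply: (@card_le_fun _ _ _ _ j) => // y z _ _.
  exact: jinj.
by have [i iP] := Scov (j \o f); exists i.
Qed.

Lemma slalom_cover_succ (k : cardinal) (I L : Type) :
    infinite_set [set: k] -> [set: K] #<= [set: k] ->
    [set: L * succ_card k] #<= [set: L] ->
  slalom_cover K I L k -> slalom_cover K I L (succ_card k).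
Proof.
move=> kinf Kk LL cov.
(* For empty [L] only an index is needed; covering a constant function provides one. *)
have [[l]|nL] := pselect (inhabited L); last first.
  have [v _] := infinite_setN0 (infinite_card_le (card_le_succ k) kinf).
  have [S Slt Scov] := cov; have [p _] := infinite_setN0 kinf.
  exists (fun _ _ => set0) => [i a|f]; first by case: nL.
  by have [i _] := Scov (fun=> p); exists i => a; case: nL.
have [s0 _] := infinite_setN0 (infinite_card_le (card_le_succ k) kinf).
have [S Slt Scov] := slalom_cover_dom (l, s0) LL cov.
have [e einj] := succ_card_code kinf.
(* The slaloms on [L * succ_card k] guess, at [(a, b)], the code of [f a] below [b]; [F i a b]
   decodes the guess. *)
pose F i a b := [set x | ole x b /\ S i (a, b) (e b x)].
have Flt i a b : F i a b #< [set: K].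
  have := Slt i (a, b); rewrite !card_ltNge; apply: contra => h.
  apply: card_le_trans h _; apply: (@card_le_fun _ _ _ _ (e b)) => [x []//|].
  by move=> x y [xb _] [yb _]; exact: einj.
exists (fun i a => [set x | exists b0, forall b, ole b0 b -> F i a b x]).
  move=> i a; rewrite card_ltNge; apply/negP.
  move=> /(card_le_exfun (inhabits s0))[c cP cinj].
  have /boolp.choice[b0 b0P] : forall x, exists b0, forall b, ole b0 b -> F i a b (c x).
    by move=> x; exact: cP.
  (* The thresholds of [K]-many caught values have a common bound [b], so [F i a b] would contain
     them all. *)
  have [b bP] := succ_card_regular b0 kinf Kk.
  have := Flt i a b; rewrite card_ltNge => /negP; apply.
  by apply: (@card_le_fun _ _ _ _ c) => [x _|//]; apply: b0P; exact: bP.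
move=> f; have [i iP] := Scov (fun p => e p.2 (f p.1)).
(* The value [f a] is its own threshold: it has a code below every [b] from [f a] on. *)
by exists i => a; exists (f a) => b fab; split=> //; exact: (iP (a, b)).
Qed.

Lemma slalom_cover_iter_succ n (I L : Type) :
    infinite_set [set: K] -> [set: iter n succ_card K] #<= [set: L] ->
  slalom_cover K I L K -> slalom_cover K I L (iter n succ_card K).
Proof.
move=> Kinf; elim: n => //= n IHn nL cov.
have KL := card_le_iter_succ n.+1 K.
apply: slalom_cover_succ.
- exact: infinite_card_le (card_le_iter_succ n K) Kinf.
- exact: card_le_iter_succ.
- apply: card_leXT => //; apply: infinite_card_le Kinf.
  exact: card_le_trans KL nL.
- by apply: IHn => //; apply: card_le_trans nL; exact: card_le_succ.
Qed.

End SlalomCover.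

(** * Slaloms from a dominating family of functions from [L] to [K] *)

Section FrakD.
Variables (L K : cardinal).
Hypotheses (Kinf : infinite_set [set: K]) (KL : [set: K] #<= [set: L]).

Let Linf : infinite_set [set: L]. Proof. exact: infinite_card_le KL Kinf. Qed.

(** Fixing one coordinate splits the image of [j] into [L]-many copies of [K], or into [K]-many
    copies of [L]; both views are used. *)
Lemma pairing_retract :
  exists (j : L * K -> L) (r : L -> L * K), cancel j r.
Proof.
have [l _] := infinite_setN0 Linf; have [k _] := infinite_setN0 Kinf.
exact/(exists_retract (l, k))/card_leXT.
Qed.

Lemma frak_d_dominating :
  exists2 D : set (L -> K), dominating (@le_star_card L K) D
                          & D #= [set: frak_d L K].
Proof.
have [k _] := infinite_setN0 Kinf.
by have [] := min_sizeP (ex_intro _ _ (@le_star_card_dominating L K (inhabits k))).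
Qed.

(* Diagonalization against [L]-many functions, each on its own copy of [K]. *)
Lemma card_le_frak_d : [set: L] #<= [set: frak_d L K].
Proof.
have [D Ddom Dd] := frak_d_dominating.
rewrite -(card_le_eqr Dd); apply: contrapT => nLD.
have [/nLD//|] := orP (card_le_total [set: L] D).
have [j [r rK]] := pairing_retract.
have [l _] := infinite_setN0 Linf.
move=> /(card_le_exfun (inhabits l))[t _ tinj].
have [k _] := infinite_setN0 Kinf.
(* [q] inverts the embedding [t] of [D] into [L], with a constant function off its range. *)
have /boolp.choice[q qP] : forall c, exists g, forall h, D h -> t h = c -> g = h.
  move=> c; have [[h [Dh <-]]|nh] := pselect (exists h, D h /\ t h = c).
    by exists h => h' Dh' tE; apply: tinj.
  by exists (fun=> k) => h Dh tE; case: nh; exists h.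
have /boolp.choice[up upP] : forall m : K, exists x, ~~ ole x m.
  by move=> m; exact: ole_unbounded.
(* On the copy of [K] with index [t g], this function exceeds [g] everywhere. *)
have [g Dg] := Ddom (fun c => up (q (r c).1 c)).
rewrite /le_star_card card_ltNge => /negP; apply.
apply: (@card_le_fun _ _ _ _ (fun x => j (t g, x))) => [x _ /=|x y _ _].
  by rewrite rK /= (qP _ g Dg erefl).
by move=> /(can_inj rK)[].
Qed.

(* A function constant along [K]-many copies of its domain is dominated
   everywhere on at least one of the copies. *)
Lemma slalom_cover_frak_d : slalom_cover K (frak_d L K) L K.
Proof.
have [D Ddom Dd] := frak_d_dominating.
have [j [r rK]] := pairing_retract.
have [l _] := infinite_setN0 Linf; have [k _] := infinite_setN0 Kinf.
have [d0 Dd0 _] := Ddom (fun=> k).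
have LD := card_le_frak_d; have dinf := infinite_card_le LD Linf.
apply: (@slalom_cover_index _ (set_type D * K)%type).
- exact: (SigSub (mem_set Dd0), k).
(* The factor [K] is absorbed because [K] is at most [L], which is at most [frak_d L K]. *)
- apply: card_leXT => //; first by rewrite (card_le_eql (card_setT D)) (card_le_eql Dd).
  exact: card_le_trans KL LD.
exists (fun i a => [set x | ole x (val i.1 (j (a, i.2)))]).
  by move=> i a; exact: closed_segment_lt.
move=> f; have [g Dg bad] := Ddom (fun c => f (r c).1).
pose E := [set c | ~~ ole (f (r c).1) (g c)].
(* Fewer than [K] exceptions cannot meet all [K]-many copies. *)
have [x xP] : exists x, forall c, E c -> (r c).2 <> x.
  apply: contrapT => nx; move: bad; rewrite /le_star_card card_ltNge => /negP.
  apply; apply: (@card_le_trans _ _ _ ((fun c => (r c).2) @` E)).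
    apply: subset_card_le => x _; apply: contrapT => nE; apply: nx; exists x.
    by move=> c Ec cx; apply: nE; exists c.
  exact: card_image_le.
exists (SigSub (mem_set Dg), x) => a /=; apply: contrapT => /negP na.
by apply: (xP (j (a, x))); rewrite /E /= rK.
Qed.

End FrakD.

(** * Eventual domination and the cardinals b and c *)

Lemma le_star_leq (x y : nat -> nat) : (forall k, x k <= y k)%N -> le_star x y.
Proof.
move=> xy; rewrite /le_star (_ : [set k | _] = set0); first exact: finite_set0.
by apply/seteqP; split=> k //=; rewrite xy.
Qed.

Lemma le_star_trans (y x z : nat -> nat) : le_star x y -> le_star y z -> le_star x z.
Proof.
move=> xy yz; apply: (@sub_finite_set _ _
    ([set k | ~~ (x k <= y k)%N] `|` [set k | ~~ (y k <= z k)%N])).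
  move=> k /= nxz; have [xyk|] := boolP (x k <= y k)%N; last by left.
  by right; apply: contra nxz; exact: leq_trans.
by rewrite finite_setU.
Qed.

Lemma frak_b_unbounded :
  exists u : frak_b -> nat -> nat, forall g, exists a, ~ le_star (u a) g.
Proof.
have [[A uA Ab] _] := min_sizeP (ex_intro _ _ le_star_unbounded).
have /(card_le_exfun frak_b_inhabited)[t _ tinj] : A #<= [set: frak_b].
  by rewrite (card_le_eql Ab).
have /boolp.choice[u uP] : forall a, exists x, forall y, A y -> t y = a -> x = y.
  move=> a; have [[y [Ay <-]]|ny] := pselect (exists y, A y /\ t y = a).
    by exists y => z Az tE; apply: tinj.
  by exists (fun=> 0) => y Ay tE; case: ny; exists y.
exists u => g; apply: contrapT => nu; apply: uA; exists g => f Af.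
by apply: contrapT => nfg; apply: nu; exists (t f); rewrite (uP _ f).
Qed.

Lemma lt_frak_b_bounded (A : set (nat -> nat)) : A #< [set: frak_b] ->
  exists g, forall f, A f -> le_star f g.
Proof.
rewrite card_ltNge => /negP bA; apply: contrapT => uA; apply: bA.
by have [_] := min_sizeP (ex_intro _ _ le_star_unbounded); exact.
Qed.

(** A finite family of reals is bounded by its pointwise sum. *)
Lemma frak_b_infinite : infinite_set [set: frak_b].
Proof.
have [u uP] := frak_b_unbounded => /(finite_image u)/finite_seqP[s sE].
have [a []] := uP (fun k => \sum_(f <- s) f k).
apply: le_star_leq => k.
have : u a \in s by have : [set` s] (u a) by rewrite -sE; exists a.
by move=> us; rewrite (big_rem _ us) leq_addr.
Qed.

(** A real is coded by the characteristic function of its graph, transported to the naturals by a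
    pairing. *)
Lemma card_frak_c : [set: frak_c] #= [set: nat -> nat].
Proof.
rewrite -(card_eql (card_ofP [set: nat -> bool])); apply: Cantor_Bernstein.
  apply: (@inj_card_leT _ _ (fun f k => nat_of_bool (f k))) => f g fg.
  by apply/funext => k; have := congr1 (@^~ k) fg; case: (f k); case: (g k).
have /card_eqPle[/(card_le_exfun (inhabits 0))[r _ rinj] _] := card_nat2.
apply: (@inj_card_leT _ _ (fun f n => `[< exists k, n = r (k, f k) >])).
move=> f g fg; apply/funext => k.
have : `[< exists i, r (k, f k) = r (i, g i) >].
  by rewrite -(congr1 (@^~ (r (k, f k))) fg); apply/asboolP; exists k.
by move=> /asboolP[i /(rinj _ _ I I)[ki ->]]; rewrite ki.
Qed.

(** * Comparison of the two dominating numbers *)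

Lemma frak_d_le_frak_d_empty : [set: frak_d frak_c frak_b] #<= [set: frak_d_empty].
Proof.
have [[D Ddom Dd] _] := min_sizeP (ex_intro _ _ le_star_empty_dominating).
have [k0] := frak_b_inhabited.
have [_ dP] := min_sizeP (ex_intro _ _ (@le_star_card_dominating frak_c frak_b (inhabits k0))).
have [u uP] := frak_b_unbounded.
have /boolp.choice[al alP] := uP.
have /boolp.choice[b bP] : forall x, exists g, forall a, ~~ ole x a -> le_star (u a) g.
  move=> x; have [|g gP] := @lt_frak_b_bounded (u @` [set a | ~~ ole x a]).
    have := ole_initial x; rewrite !card_ltNge; apply: contra => h.
    exact: card_le_trans h (card_image_le _ _).
  by exists g => a xa; apply: gP; exists a.
have [c _] : [set: frak_c] !=set0.
  apply/set0P/eqP => c0; have /card_eqPle[_] := card_frak_c.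
  by rewrite c0 card_le0 => /eqP/seteqP[/(_ (fun=> 0) I)].
have /card_eqPle[/(exists_retract c)[j [r rK]] _] := card_frak_c.
(* [h g x] is an index [a] for which [g (j x)] fails to dominate [u a]. *)
pose h (g : (nat -> nat) -> nat -> nat) x := al (g (j x)).
rewrite /frak_d_empty /dominating_number -(card_le_eqr Dd).
apply: card_le_trans (card_image_le h D); apply: dP => f.
have [g Dg fg] := Ddom (fun x => b (f (r x))).
exists (h g); first by exists g.
rewrite /le_star_card (_ : [set a | _] = set0).
  by rewrite card_ltNge; apply/negP; rewrite card_le0 => /eqP/seteqP[/(_ k0 I)].
(* If [h g x] were below [f x], the bound [b (f x)], and with it [g (j x)], would dominate
   [u (h g x)]. *)
apply/seteqP; split=> // x /= /negP[]; apply: contrapT => /negP nfh.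
apply: (alP (g (j x))); apply: le_star_trans (fg (j x)).
by rewrite rK; apply: bP.
Qed.

Theorem theorem5p9 :
  (exists n : nat, [set: frak_c] #= [set: iter n succ_card frak_b]) ->
  [set: frak_d frak_c frak_b] #= [set: frak_d_empty].
Proof.
move=> [n cn]; apply: Cantor_Bernstein; first exact: frak_d_le_frak_d_empty.
have bc : [set: frak_b] #<= [set: frak_c].
  by rewrite (card_le_eqr cn); exact: card_le_iter_succ.
have binf := frak_b_infinite.
have [p _] := infinite_setN0 (infinite_card_le (card_le_iter_succ n _) binf).
have nc : [set: iter n succ_card frak_b] #<= [set: frak_c].
  by rewrite (card_le_eqr cn).
have cov := slalom_cover_iter_succ binf nc (slalom_cover_frak_d binf bc).
(* Both c and the iterated successor have the size of the reals, so the cover transfers to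
   functionals. *)
have [S Slt Scov] : slalom_cover frak_b (frak_d frak_c frak_b) (nat -> nat) (nat -> nat).
  apply: slalom_cover_dom (fun=> 0) _ _; last apply: slalom_cover_codom p _ cov.
    by rewrite -(card_le_eql card_frak_c).
  by rewrite -(card_le_eql card_frak_c) (card_le_eql cn).
(* Each slalom value consists of fewer than b reals, so a single real [g (i, x)] bounds it. *)
have /boolp.choice[g gP] : forall q : frak_d frak_c frak_b * (nat -> nat), exists y,
    forall x, S q.1 q.2 x -> le_star x y.
  by move=> q; exact: lt_frak_b_bounded.
have [_ dP] := min_sizeP (ex_intro _ _ le_star_empty_dominating).
apply: card_le_trans (card_image_le (fun i x => g (i, x)) setT).
apply: dP => f; have [i iP] := Scov f.
by exists (fun x => g (i, x)); [exists i|move=> x; exact: (gP (i, x))].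
Qed.
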